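(* Let $\sigma>0$, let $q=\exp\left(-\frac{1}{4\sigma^2}\right)$, and define $$P(t)=\frac{\vartheta_3(t,q)}{\left[\vartheta_3(t,q^2)\right]^2},\qquad t\in[0,\pi],$$ where $\vartheta_3$ is the third Jacobi theta function. Then $P$ is monotonically decreasing on $\left(0,\frac{\pi}{2}\right)$ and monotonically increasing on $\left(\frac{\pi}{2},\pi\right)$.
   Context: The third Jacobi theta function is $\vartheta_3(t,q)=\sum_{k=-\infty}^{\infty}q^{k^2}e^{2ikt}$, $|q|<1$. *)

(* Defs.v *)
From Stdlib Require Export Reals ZArith.
From Coquelicot Require Export Coquelicot.

(* Coquelicot's notation [C] for complex numbers is shadowed by the binomial
   coefficient [C : nat -> nat -> R] of Reals, hence the qualified name. *)
Notation CC := Coquelicot.Complex.C.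

Definition Cexp (z : CC) : CC :=
  ((exp (Re z) * cos (Im z))%R, (exp (Re z) * sin (Im z))%R).

(* The two halves, k >= 0 and k <= -1, are required to converge separately. *)
Definition is_bilateral_series (a : Z -> CC) (l : CC) : Prop :=
  exists lp ln : CC,
    is_series (fun n : nat => a (Z.of_nat n)) lp /\
    is_series (fun n : nat => a (- Z.of_nat (S n))%Z) ln /\
    l = Cplus lp ln.

(* A junk value when the series diverges. *)
Definition BilateralSeries (a : Z -> CC) : CC :=
  iota (T := CompleteNormedModule.CompleteSpace _ C_CompleteNormedModule)
       (is_bilateral_series a).

Lemma is_bilateral_series_unique (a : Z -> CC) (l : CC) :
  is_bilateral_series a l -> BilateralSeries a = l.
Proof.
intros Hl.
assert (U : forall (b : nat -> CC) (x y : CC),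
          is_series b x -> is_series b y -> x = y).
{ intros b x y Hx Hy.
  exact (eq_trans (eq_sym (iota_filterlim_locally (F := eventually) _ x Hx))
                  (iota_filterlim_locally (F := eventually) _ y Hy)). }
apply (iota_unique (V := C_CompleteNormedModule)); [|exact Hl].
intros y (yp & yn & Hyp & Hyn & ->).
destruct Hl as (lp & ln & Hlp & Hln & ->).
now rewrite (U _ _ _ Hyp Hlp), (U _ _ _ Hyn Hln).
Qed.

Definition theta3_term (t q : CC) (k : Z) : CC :=
  Cmult (Cpow q (Z.abs_nat (k * k)))
        (Cexp (Cmult (Cmult (RtoC 2) Ci) (Cmult (RtoC (IZR k)) t))).

(* Meaningful for Cmod q < 1. *)
Definition theta3 (t q : CC) : CC := BilateralSeries (theta3_term t q).

Definition Pquot (q t : R) : CC :=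
  Cdiv (theta3 (RtoC t) (RtoC q))
       (Cpow (theta3 (RtoC t) (RtoC (q ^ 2)%R)) 2).

(* Main.v *)
Require Import Defs.
From Stdlib Require Import Lra Lia.
Open Scope R_scope.

(** Write f(t) for theta_3(t, q) and g(t) = f(PI/2 - t) = theta_4(t, q), and put
    a = f(0), b = g(0). The square of theta_3(t, q^2) is a double series over pairs
    of integers (m, n); collecting the terms with m + n = s yields the identity

      theta_3(t, q^2)^2 = (a f(t) + b g(t)) / 2             ([theta_landen]).

    Hence P = 2 f / (a f + b g), and when b and the denominator are positive, P
    decreases exactly when g / f increases, that is, when the cross product
    W(x, y) = f(x) g(y) - f(y) g(x) is positive for x < y ([quotient_decr]).

    The same identity transports this property between nomes. Replacing t by
    PI/2 - t exchanges f and g, so theta_3^2 and theta_4^2 at the nome q^2 are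
    images of (f, g) under a symmetric linear map of determinant (a^2 - b^2) / 4.
    Therefore positivity of theta_3 and of W at the nome q^2 implies positivity of
    W at the nome q; positivity of f follows from the signs of W(0, t) and
    W(t, PI/2), which confine the curve (f, g) to the angular sector between
    (a, b) and (b, a) ([turning_descent]). Repeated squaring makes the nome as
    small as desired, and for q <= 1/8 the first harmonic 2 q cos(2t) dominates
    all later ones, so that f is positive and decreasing and g is increasing
    ([turning_small]).

    On the second half of the period, P(PI - t) = P(t). *)

(** * Sums over the integers *)

(** Both halves start at 0, so that reflection exchanges them. *)
Definition Zsummable (u : Z -> R) : Prop :=
  ex_series (fun n => Rabs (u (Z.of_nat n))) /\
  ex_series (fun n => Rabs (u (- Z.of_nat n)%Z)).

(** The two halves are folded into one series, so that a double sum over the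
    integers is a double series over the naturals and exchanging the order is
    a single use of [Series_exchange]. *)
Definition Zsum (u : Z -> R) : R :=
  Series (fun n => u (Z.of_nat n) + u (- Z.of_nat (S n))%Z).

Lemma Zsum_ext u v : (forall k, u k = v k) -> Zsum u = Zsum v.
Proof. intros H. apply Series_ext. intros n. now rewrite !H. Qed.

Lemma ex_series_Rle (u v : nat -> R) :
  (forall n, Rabs (u n) <= v n) -> ex_series v -> ex_series u.
Proof. intros H. now apply (@ex_series_le R_AbsRing R_CompleteNormedModule). Qed.

Lemma Zsummable_le u v :
  (forall k, Rabs (u k) <= v k) -> Zsummable v -> Zsummable u.
Proof.
intros H [H1 H2]; split; [eapply ex_series_Rle; [|exact H1]|eapply ex_series_Rle; [|exact H2]];
  intros n; rewrite Rabs_Rabsolu; (eapply Rle_trans; [apply H|apply Rle_abs]).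
Qed.

Lemma Zsummable_Rabs u : Zsummable u -> Zsummable (fun k => Rabs (u k)).
Proof.
intros [H1 H2]; split; [eapply ex_series_ext; [|exact H1]|eapply ex_series_ext; [|exact H2]];
  intros n; now rewrite Rabs_Rabsolu.
Qed.

Lemma Zsummable_ext u v : (forall k, u k = v k) -> Zsummable u -> Zsummable v.
Proof.
intros E H. apply (Zsummable_le _ (fun k => Rabs (u k))).
- intros k; rewrite E; lra.
- now apply Zsummable_Rabs.
Qed.

Lemma Zsummable_scal c u : Zsummable u -> Zsummable (fun k => c * u k).
Proof.
intros [H1 H2]; split; (eapply ex_series_ext;
  [intros n; symmetry; apply Rabs_mult|]).
- exact (ex_series_scal_l (Rabs c) _ H1).
- exact (ex_series_scal_l (Rabs c) _ H2).
Qed.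

Lemma Zsummable_opp u : Zsummable u -> Zsummable (fun k => u (- k)%Z).
Proof.
intros [H1 H2]; split; [exact H2|].
eapply ex_series_ext; [|exact H1]. intros n; cbv beta. now rewrite Z.opp_involutive.
Qed.

Lemma Zsummable_succ u : Zsummable u -> Zsummable (fun k => u (k + 1)%Z).
Proof.
intros [H1 H2]; split.
- apply ex_series_incr_1 in H1. eapply ex_series_ext; [|exact H1].
  intros n; cbv beta. do 2 f_equal; lia.
- apply ex_series_incr_1. eapply ex_series_ext; [|exact H2].
  intros n; cbv beta. do 2 f_equal; lia.
Qed.

Lemma Zsummable_halves u : Zsummable u ->
  ex_series (fun n => u (Z.of_nat n)) /\ ex_series (fun n => u (- Z.of_nat n)%Z).
Proof. intros [H1 H2]; split; now apply ex_series_Rabs. Qed.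

Lemma Zsummable_tails u : Zsummable u ->
  ex_series (fun n => u (Z.of_nat n)) /\ ex_series (fun n => u (- Z.of_nat (S n))%Z).
Proof.
intros H; apply Zsummable_halves in H; destruct H as [H1 H2]; split; [exact H1|].
now apply (ex_series_incr_1 (fun n => u (- Z.of_nat n)%Z)) in H2.
Qed.

Lemma Zsum_split u : Zsummable u ->
  Zsum u = Series (fun n => u (Z.of_nat n)) + Series (fun n => u (- Z.of_nat (S n))%Z).
Proof. intros H; apply Zsummable_tails in H. now apply Series_plus. Qed.

Lemma Zsum_plus u v : Zsummable u -> Zsummable v ->
  Zsum (fun k => u k + v k) = Zsum u + Zsum v.
Proof.
intros Hu Hv; apply Zsummable_tails in Hu, Hv.
unfold Zsum. rewrite <- Series_plus; try now apply (ex_series_plus (V := R_NormedModule)).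
apply Series_ext; intros n; ring.
Qed.

Lemma Zsum_scal c u : Zsum (fun k => c * u k) = c * Zsum u.
Proof.
unfold Zsum. rewrite <- Series_scal_l. apply Series_ext; intros n; ring.
Qed.

Lemma Zsum_le u v : Zsummable u -> Zsummable v -> (forall k, u k <= v k) -> Zsum u <= Zsum v.
Proof.
intros Hu Hv H. apply Zsummable_tails in Hu, Hv.
assert (Eu : ex_series (fun n => u (Z.of_nat n) + u (- Z.of_nat (S n))%Z))
  by now apply (ex_series_plus (V := R_NormedModule)).
assert (Ev : ex_series (fun n => v (Z.of_nat n) + v (- Z.of_nat (S n))%Z))
  by now apply (ex_series_plus (V := R_NormedModule)).
enough (0 <= Zsum v - Zsum u) by lra.
unfold Zsum. rewrite <- Series_minus by assumption.
replace 0 with (Series (fun _ => 0 * 0)) by (rewrite Series_scal_l; ring).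
apply Series_le; [|now apply (ex_series_minus (V := R_NormedModule))].
intros n. assert (A := H (Z.of_nat n)). assert (B := H (- Z.of_nat (S n))%Z). lra.
Qed.

Lemma Zsum_succ u : Zsummable u -> Zsum (fun k => u (k + 1)%Z) = Zsum u.
Proof.
intros H. rewrite (Zsum_split _ (Zsummable_succ _ H)), (Zsum_split _ H).
destruct (Zsummable_halves _ H) as [H1 H2].
rewrite (Series_incr_1 (fun n => u (Z.of_nat n))) by exact H1.
assert (E := Series_incr_1 (fun n => u (- Z.of_nat n)%Z) H2). cbv beta in E.
rewrite (Series_ext (fun n => u (Z.of_nat n + 1)%Z) (fun n => u (Z.of_nat (S n))))
  by (intros n; f_equal; lia).
rewrite (Series_ext (fun n => u (- Z.of_nat (S n) + 1)%Z) (fun n => u (- Z.of_nat n)%Z))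
  by (intros n; f_equal; lia).
rewrite E. change (- Z.of_nat 0)%Z with 0%Z. change (Z.of_nat 0) with 0%Z. ring.
Qed.

(** In the folded series, [u (- k)] and [u (k + 1)] have the same terms up to
    order: reflection is a unit shift. *)
Lemma Zsum_opp u : Zsummable u -> Zsum (fun k => u (- k)%Z) = Zsum u.
Proof.
intros H. rewrite <- (Zsum_succ u H). apply Series_ext; intros n.
rewrite Rplus_comm. f_equal; f_equal; lia.
Qed.

Lemma Zsummable_shift_nat u n : Zsummable u ->
  Zsummable (fun k => u (k + Z.of_nat n)%Z) /\
  Zsum (fun k => u (k + Z.of_nat n)%Z) = Zsum u.
Proof.
intros H; induction n as [|n [IH1 IH2]].
- assert (E : forall k, u (k + Z.of_nat 0)%Z = u k) by (intros k; f_equal; lia).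
  split; [|now apply Zsum_ext]. now apply (Zsummable_ext u).
- assert (E : forall k, u (k + Z.of_nat (S n))%Z = u (k + 1 + Z.of_nat n)%Z)
    by (intros k; f_equal; lia).
  split.
  + apply (Zsummable_ext (fun k => u (k + 1 + Z.of_nat n)%Z)); [now intros k|].
    exact (Zsummable_succ _ IH1).
  + rewrite <- IH2, <- (Zsum_succ _ IH1). now apply Zsum_ext.
Qed.

Lemma Zsummable_Zsum_shift u p : Zsummable u ->
  Zsummable (fun k => u (k + p)%Z) /\ Zsum (fun k => u (k + p)%Z) = Zsum u.
Proof.
intros H. destruct (Z.le_ge_cases 0 p) as [Hp|Hp].
- rewrite <- (Z2Nat.id p Hp). now apply Zsummable_shift_nat.
- set (v := fun k => u (- k)%Z).
  destruct (Zsummable_shift_nat v (Z.to_nat (- p)) (Zsummable_opp _ H)) as [H1 H2].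
  assert (E : forall k, v (- k + Z.of_nat (Z.to_nat (- p)))%Z = u (k + p)%Z)
    by (intros k; unfold v; f_equal; lia).
  split; [exact (Zsummable_ext _ _ E (Zsummable_opp _ H1))|].
  rewrite <- (Zsum_opp u H). fold v. rewrite <- H2, <- (Zsum_opp _ H1).
  symmetry. now apply Zsum_ext.
Qed.

Lemma Zsummable_shift u p : Zsummable u -> Zsummable (fun k => u (k + p)%Z).
Proof. apply Zsummable_Zsum_shift. Qed.

Lemma Zsum_shift u p : Zsummable u -> Zsum (fun k => u (k + p)%Z) = Zsum u.
Proof. apply Zsummable_Zsum_shift. Qed.

Lemma is_lim_seq_Series (a : nat -> R) (l : R) : is_lim_seq (sum_n a) l -> Series a = l.
Proof. exact (is_series_unique a l). Qed.

Lemma sum_n_pairs (w : nat -> R) N :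
  sum_n w (S (2 * N)) = sum_n (fun n => w (2 * n)%nat + w (S (2 * n))) N.
Proof.
induction N as [|N IH].
- change (2 * 0)%nat with 0%nat. rewrite sum_Sn, !sum_O. reflexivity.
- replace (S (2 * S N))%nat with (S (S (S (2 * N)))) by lia.
  rewrite (sum_Sn _ N), <- IH, !sum_Sn.
  replace (2 * S N)%nat with (S (S (2 * N))) by lia.
  unfold plus; simpl; ring.
Qed.

Lemma Series_pairs (w : nat -> R) : ex_series w ->
  Series (fun n => w (2 * n)%nat + w (S (2 * n))) = Series w.
Proof.
intros H. apply is_lim_seq_Series.
apply (is_lim_seq_ext (fun N => sum_n w (S (2 * N)))); [intros N; apply sum_n_pairs|].
apply (is_lim_seq_subseq (sum_n w) (Series w) (fun N => S (2 * N))).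
- apply eventually_subseq. intros n; lia.
- exact (Series_correct w H).
Qed.

(** Grouping consecutive terms of the folded series two by two already separates
    the parities: with [n] and [- (n + 1)] of opposite parity, each group of four
    holds one pair of even and one pair of odd arguments. *)
Lemma Zsum_parity u : Zsummable u ->
  Zsummable (fun k => u (2 * k)%Z) -> Zsummable (fun k => u (2 * k + 1)%Z) ->
  Zsum u = Zsum (fun k => u (2 * k)%Z) + Zsum (fun k => u (2 * k + 1)%Z).
Proof.
intros H He Ho. rewrite <- Zsum_plus by assumption.
destruct (Zsummable_tails _ H) as [H1 H2].
unfold Zsum. rewrite <- Series_pairs by now apply (ex_series_plus (V := R_NormedModule)).
apply Series_ext; intros n.
replace (Z.of_nat (2 * n)) with (2 * Z.of_nat n)%Z by lia.
replace (Z.of_nat (S (2 * n))) with (2 * Z.of_nat n + 1)%Z by lia.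
replace (- Z.of_nat (S (S (2 * n))))%Z with (2 * - Z.of_nat (S n))%Z by lia.
replace (- (2 * Z.of_nat n + 1))%Z with (2 * - Z.of_nat (S n) + 1)%Z by lia.
ring.
Qed.

Lemma sum_n_Series (F : nat -> nat -> R) N :
  (forall i, ex_series (F i)) ->
  ex_series (fun j => sum_n (fun i => F i j) N) /\
  sum_n (fun i => Series (F i)) N = Series (fun j => sum_n (fun i => F i j) N).
Proof.
intros H. induction N as [|N [IH1 IH2]].
- split.
  + eapply ex_series_ext; [|apply (H 0%nat)]. intros j; now rewrite sum_O.
  + rewrite sum_O. apply Series_ext; intros j; now rewrite sum_O.
- split.
  + eapply ex_series_ext; [|apply (ex_series_plus (V := R_NormedModule) _ _ IH1 (H (S N)))].
    intros j; now rewrite sum_Sn.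
  + rewrite sum_Sn, IH2. unfold plus; simpl. rewrite <- Series_plus; auto.
    apply Series_ext; intros j; now rewrite sum_Sn.
Qed.

(** The partial sums over [i] may be moved inside the sum over [j], and they
    differ from the full inner sums by at most [v j] times the tail of [u]; the
    total error is that tail times the sum of [v]. *)
Lemma Series_exchange (F : nat -> nat -> R) (u v : nat -> R) :
  (forall i j, Rabs (F i j) <= u i * v j) -> ex_series u -> ex_series v ->
  Series (fun i => Series (F i)) = Series (fun j => Series (fun i => F i j)).
Proof.
intros HF Hu Hv.
assert (Hrow : forall i, ex_series (F i)).
{ intros i; eapply ex_series_Rle; [apply HF|].
  exact (ex_series_scal_l (u i) v Hv). }
assert (Hcol : forall j, ex_series (fun i => F i j)).
{ intros j; eapply ex_series_Rle; [intros i; apply HF|].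
  exact (ex_series_scal_r (v j) u Hu). }
assert (Hcs : ex_series (fun j => Series (fun i => F i j))).
{ apply (ex_series_Rle _ (fun j => Series u * v j)); [|exact (ex_series_scal_l _ v Hv)].
  intros j. rewrite <- Series_scal_r.
  assert (Hd : ex_series (fun i => u i * v j)) by exact (ex_series_scal_r (v j) u Hu).
  eapply Rle_trans; [apply Series_Rabs|apply Series_le; [|exact Hd]].
  - eapply ex_series_Rle; [|exact Hd]. intros i; rewrite Rabs_Rabsolu; apply HF.
  - intros i; split; [apply Rabs_pos|apply HF]. }
apply is_lim_seq_Series.
apply (is_lim_seq_ext (fun N => Series (fun j => sum_n (fun i => F i j) N))).
{ intros N; symmetry; now apply sum_n_Series. }
set (L := Series (fun j => Series (fun i => F i j))).
set (tail := fun N => Series u - sum_n u N).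
assert (Ht : is_lim_seq (fun N => tail N * Series v) 0).
{ replace (Finite 0) with (Rbar_mult (Series u - Series u) (Series v))
    by (simpl; f_equal; ring).
  apply is_lim_seq_mult'; [|apply is_lim_seq_const].
  apply is_lim_seq_minus'; [apply is_lim_seq_const|exact (Series_correct u Hu)]. }
assert (Hb : forall N, Rabs (Series (fun j => sum_n (fun i => F i j) N) - L) <= tail N * Series v).
{ intros N. unfold L.
  rewrite <- Series_minus; [|now apply sum_n_Series|exact Hcs].
  rewrite <- Series_scal_l.
  assert (Hd : ex_series (fun j => tail N * v j)) by exact (ex_series_scal_l _ v Hv).
  assert (Hj : forall j, Rabs (sum_n (fun i => F i j) N - Series (fun i => F i j)) <= tail N * v j).
  { intros j. unfold tail.
    rewrite (Series_incr_n _ (S N)) by (lia || apply Hcol).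
    rewrite (Series_incr_n u (S N)) by (lia || apply Hu).
    rewrite !sum_n_Reals. simpl pred.
    replace (_ - (_ + Series (fun k => F (S N + k)%nat j)))
      with (- Series (fun k => F (S N + k)%nat j)) by ring.
    replace (sum_f_R0 u N + Series (fun k => u (S N + k)%nat) - sum_f_R0 u N)
      with (Series (fun k => u (S N + k)%nat)) by ring.
    rewrite Rabs_Ropp, <- Series_scal_r.
    assert (Hd' : ex_series (fun k => u (S N + k)%nat * v j)).
    { apply (ex_series_scal_r (v j)). now apply (ex_series_incr_n u). }
    eapply Rle_trans; [apply Series_Rabs|apply Series_le; [|exact Hd']].
    - eapply ex_series_Rle; [|exact Hd']. intros i; rewrite Rabs_Rabsolu; apply HF.
    - intros i; split; [apply Rabs_pos|apply HF]. }
  eapply Rle_trans; [apply Series_Rabs|apply Series_le; [|exact Hd]].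
  - eapply ex_series_Rle; [|exact Hd]. intros i; rewrite Rabs_Rabsolu; apply Hj.
  - intros i; split; [apply Rabs_pos|apply Hj]. }
apply (is_lim_seq_le_le (fun N => L - tail N * Series v) _ (fun N => L + tail N * Series v)).
- intros N. specialize (Hb N). apply Rabs_le_between in Hb. lra.
- replace (Finite L) with (Finite (L - 0)) by (f_equal; ring).
  apply is_lim_seq_minus'; [apply is_lim_seq_const|exact Ht].
- replace (Finite L) with (Finite (L + 0)) by (f_equal; ring).
  apply is_lim_seq_plus'; [apply is_lim_seq_const|exact Ht].
Qed.

Lemma Zsum_exchange (F : Z -> Z -> R) (u v : Z -> R) :
  (forall m n, Rabs (F m n) <= u m * v n) -> Zsummable u -> Zsummable v ->
  Zsum (fun m => Zsum (F m)) = Zsum (fun n => Zsum (fun m => F m n)).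
Proof.
intros HF Hu Hv.
assert (Hrow : forall m, Zsummable (F m)).
{ intros m; eapply Zsummable_le; [apply HF|]. now apply Zsummable_scal. }
assert (Hcol : forall n, Zsummable (fun m => F m n)).
{ intros n; apply Zsummable_le with (fun m => v n * u m).
  - intros m; rewrite Rmult_comm; apply HF.
  - now apply Zsummable_scal. }
set (fold := fun (w : Z -> R) (n : nat) => w (Z.of_nat n) + w (- Z.of_nat (S n))%Z).
assert (Hf : forall w, Zsummable w -> ex_series (fold w)).
{ intros w Hw; apply Zsummable_tails in Hw. now apply (ex_series_plus (V := R_NormedModule)). }
set (G := fun i j => fold (fun m => fold (F m) j) i).
transitivity (Series (fun i => Series (G i))).
{ apply Series_ext; intros i. unfold Zsum at 1 2, G, fold.
  rewrite <- Series_plus by (apply Hf, Hrow). reflexivity. }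
rewrite (Series_exchange G (fold (fun k => Rabs (u k))) (fold (fun k => Rabs (v k)))).
- apply Series_ext; intros j. unfold Zsum.
  rewrite <- Series_plus by (apply (Hf (fun m => F m _)), Hcol).
  apply Series_ext; intros i. unfold G, fold. ring.
- intros i j. unfold G, fold.
  assert (HF' : forall m n, Rabs (F m n) <= Rabs (u m) * Rabs (v n)).
  { intros m n. rewrite <- Rabs_mult. eapply Rle_trans; [apply HF|apply Rle_abs]. }
  assert (A := HF' (Z.of_nat i) (Z.of_nat j)).
  assert (B := HF' (Z.of_nat i) (- Z.of_nat (S j))%Z).
  assert (C := HF' (- Z.of_nat (S i))%Z (Z.of_nat j)).
  assert (D := HF' (- Z.of_nat (S i))%Z (- Z.of_nat (S j))%Z).
  eapply Rle_trans; [apply Rabs_triang|].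
  eapply Rle_trans; [apply Rplus_le_compat; apply Rabs_triang|]. lra.
- now apply Hf, Zsummable_Rabs.
- now apply Hf, Zsummable_Rabs.
Qed.

(** * The theta function of a real argument *)

Lemma pow_decr q m n : 0 <= q <= 1 -> (n <= m)%nat -> 0 <= q ^ m <= q ^ n.
Proof.
intros Hq H. split; [now apply pow_le|].
replace m with (n + (m - n))%nat by lia. rewrite pow_add.
rewrite <- (Rmult_1_r (q ^ n)) at 2.
apply Rmult_le_compat_l; [now apply pow_le|].
rewrite <- (pow1 (m - n)). now apply pow_incr.
Qed.

Lemma abs_nat_le_square m : (Z.abs_nat m <= Z.abs_nat (m * m))%nat.
Proof. rewrite Zabs2Nat.inj_mul. nia. Qed.

Lemma Zsummable_geom q : 0 <= q < 1 -> Zsummable (fun k => q ^ Z.abs_nat k).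
Proof.
intros Hq.
assert (H : ex_series (fun n => q ^ n)).
{ exists (/ (1 - q)). apply is_series_geom. rewrite Rabs_pos_eq; lra. }
split; (eapply ex_series_ext; [|exact H]); intros n; cbv beta;
  rewrite Rabs_pos_eq by (apply pow_le; lra); f_equal; lia.
Qed.

Lemma Zsummable_gauss q c : 0 <= q < 1 -> (forall k, Rabs (c k) <= 1) ->
  Zsummable (fun k => q ^ Z.abs_nat (k * k) * c k).
Proof.
intros Hq Hc. apply (Zsummable_le _ (fun k => q ^ Z.abs_nat k)); [|now apply Zsummable_geom].
intros k.
assert (H := pow_decr q (Z.abs_nat (k * k)) (Z.abs_nat k) ltac:(lra) (abs_nat_le_square k)).
rewrite Rabs_mult, (Rabs_pos_eq (q ^ _)) by lra.
assert (A := Hc k). assert (B := Rabs_pos (c k)). nra.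
Qed.

(** The sine parts of the terms cancel between [k] and [- k], which leaves these
    cosine parts. *)
Definition theta (q t : R) : R :=
  Zsum (fun k => q ^ Z.abs_nat (k * k) * cos (2 * IZR k * t)).

Lemma Rabs_cos_le x : Rabs (cos x) <= 1.
Proof. apply Rabs_le. apply COS_bound. Qed.
Lemma Rabs_sin_le x : Rabs (sin x) <= 1.
Proof. apply Rabs_le. apply SIN_bound. Qed.

Lemma Zsum_gauss_sin q t : 0 <= q < 1 ->
  Zsum (fun k => q ^ Z.abs_nat (k * k) * sin (2 * IZR k * t)) = 0.
Proof.
intros Hq. set (u := fun k => _).
assert (Hu : Zsummable u) by (apply Zsummable_gauss; [exact Hq|intros k; apply Rabs_sin_le]).
assert (E := Zsum_opp u Hu).
assert (E' : Zsum (fun k => u (- k)%Z) = - 1 * Zsum u).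
{ rewrite <- Zsum_scal. apply Zsum_ext; intros k. unfold u.
  rewrite opp_IZR. replace (- k * - k)%Z with (k * k)%Z by ring.
  replace (2 * - IZR k * t) with (- (2 * IZR k * t)) by ring. rewrite sin_neg. ring. }
lra.
Qed.

Definition Zsign (k : Z) : R := if Z.even k then 1 else - 1.

Lemma Zsign_even k : Zsign (2 * k) = 1.
Proof. unfold Zsign. now rewrite Z.even_mul. Qed.

Lemma Zsign_odd k : Zsign (2 * k + 1) = - 1.
Proof. unfold Zsign. now rewrite Z.even_add, Z.even_mul. Qed.

Lemma Rabs_Zsign k : Rabs (Zsign k) = 1.
Proof. unfold Zsign. destruct (Z.even k); [apply Rabs_R1|rewrite Rabs_left; lra]. Qed.

Lemma sin_IZR_PI k : sin (IZR k * PI) = 0.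
Proof. apply sin_eq_0_1. now exists k. Qed.

Lemma cos_IZR_PI k : cos (IZR k * PI) = Zsign k.
Proof.
destruct (Z.Even_or_Odd k) as [[j ->]|[j ->]].
- rewrite Zsign_even, mult_IZR.
  replace (IZR 2 * IZR j * PI) with (2 * (IZR j * PI)) by ring.
  rewrite cos_2a_sin, sin_IZR_PI. ring.
- rewrite Zsign_odd, plus_IZR, mult_IZR.
  replace ((IZR 2 * IZR j + 1) * PI) with (2 * (IZR j * PI) + PI) by ring.
  rewrite neg_cos, cos_2a_sin, sin_IZR_PI. ring.
Qed.

(** As the fourth theta function is the third one translated by [PI / 2], this
    is its Fourier series. *)
Lemma theta_reflect q t :
  theta q (PI / 2 - t) = Zsum (fun k => q ^ Z.abs_nat (k * k) * (Zsign k * cos (2 * IZR k * t))).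
Proof.
apply Zsum_ext; intros k.
replace (2 * IZR k * (PI / 2 - t)) with (IZR k * PI - 2 * IZR k * t) by field.
rewrite cos_minus, sin_IZR_PI, cos_IZR_PI. ring.
Qed.

Lemma theta_PI_minus q t : theta q (PI - t) = theta q t.
Proof.
transitivity (theta q (PI / 2 - (PI / 2 - t))); [|f_equal; field].
replace (PI - t) with (PI / 2 - (t - PI / 2)) by field.
rewrite !theta_reflect. apply Zsum_ext; intros k.
rewrite <- (cos_neg (2 * IZR k * (t - PI / 2))). do 3 f_equal. ring.
Qed.

(** * The quadratic identity between the nomes q and q^2 *)

(** Multiplying out the square gives a sum over pairs [(m, n)]. With [s = m + n],
    the exponent [2 (m^2 + n^2)] of [q] is [s^2 + (2 m - s)^2], so that summing
    over [m] first leaves a Fourier series in [s]. *)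
Lemma theta_squared_convolution q t : 0 <= q < 1 ->
  theta (q ^ 2) t ^ 2 =
  Zsum (fun s => q ^ Z.abs_nat (s * s) * cos (2 * IZR s * t) *
    Zsum (fun m => q ^ Z.abs_nat ((2 * m - s) * (2 * m - s)))).
Proof.
intros Hq.
assert (Hq2 : 0 <= q ^ 2 < 1) by (simpl; nra).
set (w := fun k => (q ^ 2) ^ Z.abs_nat (k * k)).
(* The product with [theta] is a single translated series: the sine terms of the
   addition formula sum to 0. *)
assert (Hrow : forall m, w m * cos (2 * IZR m * t) * theta (q ^ 2) t =
  Zsum (fun s => w m * w (s - m)%Z * cos (2 * IZR s * t))).
{ intros m.
  rewrite <- (Zsum_shift (fun s => _) m).
  2:{ apply (Zsummable_ext (fun s => w m * (w (s - m)%Z * cos (2 * IZR s * t))));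
      [intros s; ring|]. apply Zsummable_scal.
      assert (H := Zsummable_gauss (q ^ 2) (fun k => cos (2 * IZR (k + m) * t)) Hq2
        ltac:(intros; apply Rabs_cos_le)).
      apply (Zsummable_shift _ (- m)) in H.
      eapply Zsummable_ext; [|exact H]. intros s; cbv beta.
      replace (s + - m + m)%Z with s by ring. reflexivity. }
  transitivity (Zsum (fun n => w m * cos (2 * IZR m * t) * (w n * cos (2 * IZR n * t))
     + (- (w m * sin (2 * IZR m * t))) * (w n * sin (2 * IZR n * t)))).
  - rewrite Zsum_plus by (apply Zsummable_scal, Zsummable_gauss;
      [exact Hq2|intros; apply Rabs_cos_le || apply Rabs_sin_le]).
    rewrite !Zsum_scal.
    assert (Hs : Zsum (fun n => w n * sin (2 * IZR n * t)) = 0) by exact (Zsum_gauss_sin _ t Hq2).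
    rewrite Hs. change (theta (q ^ 2) t) with (Zsum (fun n => w n * cos (2 * IZR n * t))). ring.
  - apply Zsum_ext; intros n.
    replace (n + m - m)%Z with n by ring.
    rewrite plus_IZR.
    replace (2 * (IZR n + IZR m) * t) with (2 * IZR m * t + 2 * IZR n * t) by ring.
    rewrite cos_plus. ring. }
transitivity (Zsum (fun m => Zsum (fun s => w m * w (s - m)%Z * cos (2 * IZR s * t)))).
{ rewrite <- (Zsum_ext _ _ Hrow).
  rewrite (Zsum_ext _ (fun m => theta (q ^ 2) t * (w m * cos (2 * IZR m * t))))
    by (intros m; ring).
  rewrite Zsum_scal.
  change (theta (q ^ 2) t) with (Zsum (fun m => w m * cos (2 * IZR m * t))). ring. }
rewrite (Zsum_exchange _ (fun m => q ^ Z.abs_nat m) (fun s => q ^ Z.abs_nat s)).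
- apply Zsum_ext; intros s. rewrite <- Zsum_scal. apply Zsum_ext; intros m.
  unfold w. rewrite <- !pow_mult.
  transitivity (q ^ (2 * Z.abs_nat (m * m) + 2 * Z.abs_nat ((s - m) * (s - m)))
     * cos (2 * IZR s * t)); [rewrite pow_add; ring|].
  replace (2 * Z.abs_nat (m * m) + 2 * Z.abs_nat ((s - m) * (s - m)))%nat
    with (Z.abs_nat (s * s) + Z.abs_nat ((2 * m - s) * (2 * m - s)))%nat
    by (apply Nat2Z.inj; rewrite !Nat2Z.inj_add, !Nat2Z.inj_mul, !Zabs2Nat.id_abs, !Z.abs_eq by apply Z.square_nonneg; change (Z.of_nat 2) with 2%Z; ring).
  rewrite pow_add. ring.
- intros m s. unfold w. rewrite <- !pow_mult, <- !pow_add, Rabs_mult.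
  assert (H := pow_decr q (2 * Z.abs_nat (m * m) + 2 * Z.abs_nat ((s - m) * (s - m)))
    (Z.abs_nat m + Z.abs_nat s) ltac:(lra)
    ltac:(assert (A := abs_nat_le_square m); assert (B := abs_nat_le_square (s - m)); lia)).
  rewrite (Rabs_pos_eq (q ^ _)) by lra.
  assert (A := Rabs_cos_le (2 * IZR s * t)). assert (B := Rabs_pos (cos (2 * IZR s * t))). nra.
- now apply Zsummable_geom.
- now apply Zsummable_geom.
Qed.

(** The squares of the integers congruent to [s] modulo 2 are selected by
    averaging the theta values at [0] and at [PI / 2], whose terms differ by the
    sign [(-1)^k]. *)
Lemma theta_parity q : 0 <= q < 1 -> forall s,
  Zsum (fun m => q ^ Z.abs_nat ((2 * m - s) * (2 * m - s))) =
  / 2 * (theta q 0 + Zsign s * theta q (PI / 2)).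
Proof.
intros Hq.
set (v := fun k => q ^ Z.abs_nat (k * k)).
assert (Hlin : forall c, Zsummable (fun m => v (2 * m + c)%Z)).
(* Only the offsets 0 and 1 need a bound, the other ones being translates. *)
{ intros c. apply (Zsummable_ext (fun m => v (2 * (m + c / 2) + c mod 2)%Z)).
  { intros m. f_equal. rewrite (Z.div_mod c 2) at 3 by lia. ring. }
  apply (Zsummable_shift (fun m => v (2 * m + c mod 2)%Z)).
  apply (Zsummable_le _ (fun k => q ^ Z.abs_nat k)); [|now apply Zsummable_geom].
  intros m. assert (Hc := Z.mod_pos_bound c 2 ltac:(lia)).
  assert (H := pow_decr q (Z.abs_nat ((2 * m + c mod 2) * (2 * m + c mod 2)))
    (Z.abs_nat m) ltac:(lra)
    ltac:(assert (A := abs_nat_le_square (2 * m + c mod 2)); lia)).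
  unfold v. rewrite Rabs_pos_eq; lra. }
assert (He : Zsummable (fun m => v (2 * m)%Z)).
{ apply (Zsummable_ext (fun m => v (2 * m + 0)%Z)); [intros; f_equal; ring|apply Hlin]. }
assert (H0 : Zsum (fun m => v (2 * m)%Z) + Zsum (fun m => v (2 * m + 1)%Z) = theta q 0).
{ rewrite <- Zsum_parity; [|apply (Zsummable_ext (fun k => v k * 1));
    [intros; ring|apply Zsummable_gauss; [exact Hq|intros; rewrite Rabs_R1; lra]]|exact He|apply Hlin].
  apply Zsum_ext; intros k. rewrite Rmult_0_r, cos_0. unfold v; ring. }
assert (H1 : Zsum (fun m => v (2 * m)%Z) - Zsum (fun m => v (2 * m + 1)%Z) = theta q (PI / 2)).
{ replace (PI / 2) with (PI / 2 - 0) by ring. rewrite theta_reflect.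
  rewrite (Zsum_ext (fun k => _ * (Zsign k * _)) (fun k => v k * Zsign k))
    by (intros k; rewrite Rmult_0_r, cos_0; unfold v; ring).
  assert (Ee : forall k, v (2 * k)%Z = v (2 * k)%Z * Zsign (2 * k))
    by (intros k; rewrite Zsign_even; ring).
  assert (Eo : forall k, - 1 * v (2 * k + 1)%Z = v (2 * k + 1)%Z * Zsign (2 * k + 1))
    by (intros k; rewrite Zsign_odd; ring).
  rewrite (Zsum_parity (fun k => v k * Zsign k)).
  - rewrite <- (Zsum_ext _ _ Ee), <- (Zsum_ext _ _ Eo), Zsum_scal. ring.
  - apply Zsummable_gauss; [exact Hq|intros k; rewrite Rabs_Zsign; lra].
  - exact (Zsummable_ext _ _ Ee He).
  - exact (Zsummable_ext _ _ Eo (Zsummable_scal _ _ (Hlin 1%Z))). }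
intros s. rewrite <- H0, <- H1.
destruct (Z.Even_or_Odd s) as [[j ->]|[j ->]].
- rewrite Zsign_even.
  rewrite <- (Zsum_shift (fun m => v (2 * m)%Z) (- j)) by exact He.
  transitivity (Zsum (fun m => v (2 * (m + - j))%Z)); [|field].
  apply Zsum_ext; intros m. unfold v. do 2 f_equal. ring.
- rewrite Zsign_odd.
  rewrite <- (Zsum_shift (fun m => v (2 * m + 1)%Z) (- j - 1)) by apply Hlin.
  transitivity (Zsum (fun m => v (2 * (m + (- j - 1)) + 1)%Z)); [|field].
  apply Zsum_ext; intros m. unfold v. do 2 f_equal. ring.
Qed.

(** By [theta_parity], the coefficient of [cos (2 s t)] in the convolution
    depends on [s] only through the sign [(-1)^s], hence the square is a
    combination of [theta q] and of its alternating companion. *)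
Lemma theta_landen q t : 0 <= q < 1 ->
  theta (q ^ 2) t ^ 2 =
  / 2 * (theta q 0 * theta q t + theta q (PI / 2) * theta q (PI / 2 - t)).
Proof.
intros Hq. rewrite theta_squared_convolution, theta_reflect by exact Hq.
unfold theta at 2. rewrite <- !Zsum_scal, <- Zsum_plus, <- Zsum_scal.
- apply Zsum_ext; intros s. rewrite theta_parity by exact Hq. ring.
- apply Zsummable_scal, Zsummable_gauss; [exact Hq|intros; apply Rabs_cos_le].
- apply Zsummable_scal, Zsummable_gauss; [exact Hq|]. intros k.
  rewrite Rabs_mult, Rabs_Zsign, Rmult_1_l. apply Rabs_cos_le.
Qed.

(** * Turning of the theta curve *)

(** The plane cross product of the points with parameters [x] and [y] of the curve
    [t |-> (theta q t, theta q (PI / 2 - t))]: a finite-difference Wronskian. *)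
Definition wronskian (q x y : R) : R :=
  theta q x * theta q (PI / 2 - y) - theta q y * theta q (PI / 2 - x).

(** The property that descends from the nome [q^2] to [q]: the curve turns strictly
    counterclockwise. Positivity is carried along because squaring coordinates
    respects the sense of rotation only in the positive quadrant. *)
Definition turning (q : R) : Prop :=
  (forall t, 0 <= t <= PI / 2 -> 0 < theta q t) /\
  (forall x y, 0 <= x -> x < y -> y <= PI / 2 -> 0 < wronskian q x y).

(** * Small nomes *)

Lemma Rabs_sin_mult_le n z : Rabs (sin (INR n * z)) <= INR n * Rabs (sin z).
Proof.
induction n as [|n IH].
- simpl. rewrite !Rmult_0_l, sin_0, Rabs_R0. lra.
- rewrite S_INR, Rmult_plus_distr_r, Rmult_1_l, sin_plus.
  eapply Rle_trans; [apply Rabs_triang|]. rewrite !Rabs_mult.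
  assert (A := Rabs_cos_le z). assert (B := Rabs_cos_le (INR n * z)).
  assert (C := Rabs_pos (sin (INR n * z))). assert (D := Rabs_pos (sin z)). nra.
Qed.

(** A difference of cosines is a product of two sines, and each of these grows at
    most by the factor [n]. This compares every harmonic with the first one. *)
Lemma Rabs_cos_mult_sub_le n a b :
  Rabs (cos (INR n * a) - cos (INR n * b)) <= INR n ^ 2 * Rabs (cos a - cos b).
Proof.
rewrite !form2, !Rabs_mult.
replace ((INR n * a - INR n * b) / 2) with (INR n * ((a - b) / 2)) by field.
replace ((INR n * a + INR n * b) / 2) with (INR n * ((a + b) / 2)) by field.
set (u := (a - b) / 2). set (v := (a + b) / 2).
assert (A := Rabs_sin_mult_le n u). assert (B := Rabs_sin_mult_le n v).
assert (A' := Rabs_pos (sin (INR n * u))). assert (B' := Rabs_pos (sin (INR n * v))).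
assert (H := Rmult_le_compat _ _ _ _ A' B' A B).
rewrite (Rabs_left (-2)) by lra. nra.
Qed.

Lemma theta_Fourier q t : 0 <= q < 1 ->
  ex_series (fun n => q ^ (S n * S n) * cos (INR (S n) * (2 * t))) /\
  theta q t = 1 + 2 * Series (fun n => q ^ (S n * S n) * cos (INR (S n) * (2 * t))).
Proof.
intros Hq. set (w := fun n : nat => q ^ (n * n) * cos (INR n * (2 * t))).
assert (H : Zsummable (fun k => q ^ Z.abs_nat (k * k) * cos (2 * IZR k * t)))
  by (apply Zsummable_gauss; [exact Hq|intros; apply Rabs_cos_le]).
assert (Ep : forall n, q ^ Z.abs_nat (Z.of_nat n * Z.of_nat n) * cos (2 * IZR (Z.of_nat n) * t) = w n).
{ intros n. unfold w. rewrite <- INR_IZR_INZ, Zabs2Nat.inj_mul, Zabs2Nat.id.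
  f_equal; f_equal; ring. }
assert (En : forall n, q ^ Z.abs_nat (- Z.of_nat n * - Z.of_nat n) * cos (2 * IZR (- Z.of_nat n) * t) = w n).
{ intros n. rewrite Z.mul_opp_opp, opp_IZR, <- Ep.
  rewrite <- (cos_neg (2 * IZR (Z.of_nat n) * t)). f_equal; f_equal; ring. }
destruct (Zsummable_halves _ H) as [H1 _].
apply (ex_series_ext _ _ Ep) in H1.
assert (H2 : ex_series (fun n => w (S n))) by now apply ex_series_incr_1 in H1.
split; [exact H2|].
unfold theta. rewrite (Zsum_split _ H), (Series_ext _ _ Ep), (Series_ext _ _ (fun n => En (S n))).
rewrite (Series_incr_1 w) by exact H1.
unfold w at 1. change (INR 0) with 0. rewrite Rmult_0_l, cos_0.
change (fun n => q ^ (S n * S n) * cos (INR (S n) * (2 * t))) with (fun n => w (S n)).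
change (0 * 0)%nat with 0%nat. rewrite pow_O. ring.
Qed.

(** The terms beyond the constant 1 are dominated by a geometric series of sum
    [2 q / (1 - q) < 1]. *)
Lemma theta_pos_small q t : 0 <= q <= / 8 -> 0 < theta q t.
Proof.
intros Hq. destruct (theta_Fourier q t) as [H ->]; [lra|].
set (w := fun n => _) in *.
assert (Hw : forall n, 0 <= Rabs (w n) <= q * q ^ n).
{ intros n. split; [apply Rabs_pos|]. unfold w. rewrite Rabs_mult.
  assert (A := pow_decr q (S n * S n) (S n) ltac:(lra) ltac:(nia)).
  rewrite (Rabs_pos_eq (q ^ _)) by lra.
  assert (B := Rabs_cos_le (INR (S n) * (2 * t))).
  assert (C := Rabs_pos (cos (INR (S n) * (2 * t)))).
  change (q * q ^ n) with (q ^ S n). nra. }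
assert (Hg : is_series (fun n => q ^ n) (/ (1 - q))) by (apply is_series_geom; rewrite Rabs_pos_eq; lra).
assert (He : ex_series (fun n => q * q ^ n)) by exact (ex_series_scal_l q _ (ex_intro _ _ Hg)).
assert (Ha : ex_series (fun n => Rabs (w n))).
{ eapply ex_series_Rle; [|exact He]. intros n. rewrite Rabs_Rabsolu. apply Hw. }
assert (B := Series_Rabs w Ha). assert (B' := Series_le _ _ Hw He).
rewrite Series_scal_l, (is_series_unique (pow _) _ Hg) in B'.
assert (q * / (1 - q) < / 2).
{ apply Rmult_lt_reg_r with (1 - q); [lra|]. rewrite Rmult_assoc, Rinv_l; lra. }
assert (D := Rle_trans _ _ _ B B'). apply Rabs_le_between in D. lra.
Qed.

Lemma square_le_pow4 n : INR (S (S n)) ^ 2 <= 4 ^ S n.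
Proof.
induction n as [|n IH].
- simpl. lra.
- rewrite S_INR. change (4 ^ S (S n)) with (4 * 4 ^ S n).
  assert (2 <= INR (S (S n))) by (rewrite !S_INR; assert (A := pos_INR n); lra). nra.
Qed.

(** The first harmonic contributes [q d] with [d = cos (2 x) - cos (2 y)], and by
    [Rabs_cos_mult_sub_le] the later ones contribute at most the sum of the
    [k^2 q^(k^2) d] for [k >= 2], which is at most [q d / 8]. *)
Lemma theta_decr_small q x y : 0 < q <= / 8 ->
  0 <= x -> x < y -> y <= PI / 2 -> theta q y < theta q x.
Proof.
intros Hq Hx Hxy Hy.
destruct (theta_Fourier q x) as [Hx1 ->]; [lra|].
destruct (theta_Fourier q y) as [Hy1 ->]; [lra|].
set (d := cos (2 * x) - cos (2 * y)).
assert (Hd : 0 < d).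
{ unfold d. assert (cos (2 * y) < cos (2 * x)) by (apply cos_decreasing_1; lra). lra. }
enough (0 < Series (fun n => q ^ (S n * S n) * cos (INR (S n) * (2 * x))) -
   Series (fun n => q ^ (S n * S n) * cos (INR (S n) * (2 * y)))) by lra.
rewrite <- Series_minus by assumption.
set (w := fun n => _).
assert (Hw1 : ex_series w) by now apply (ex_series_minus (V := R_NormedModule)).
rewrite Series_incr_1 by exact Hw1.
replace (w 0%nat) with (q * d) by (unfold w, d; simpl; rewrite !Rmult_1_l, !Rmult_1_r; ring).
assert (Hw : forall n, 0 <= Rabs (w (S n)) <= / 16 * q * d * (/ 2) ^ n).
{ intros n. split; [apply Rabs_pos|]. unfold w.
  rewrite <- Rmult_minus_distr_l, Rabs_mult.
  assert (A := Rabs_cos_mult_sub_le (S (S n)) (2 * x) (2 * y)).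
  fold d in A. rewrite (Rabs_pos_eq d) in A by lra.
  assert (B := pow_decr q (S (S n) * S (S n)) (S (S (S n))) ltac:(lra) ltac:(nia)).
  rewrite (Rabs_pos_eq (q ^ _)) by lra.
  assert (C := square_le_pow4 n).
  assert (E : q ^ S (S (S n)) * 4 ^ S n <= / 16 * q * (/ 2) ^ n).
  { assert (F : (q * 4) ^ n <= (/ 2) ^ n) by (apply pow_incr; lra).
    rewrite Rpow_mult_distr in F. simpl.
    assert (G : 0 <= q ^ n * 4 ^ n) by (apply Rmult_le_pos; apply pow_le; lra).
    assert (K : q * q * 4 <= / 16) by nra.
    replace (q * (q * (q * q ^ n)) * (4 * 4 ^ n)) with (q * ((q * q * 4) * (q ^ n * 4 ^ n))) by ring.
    replace (/ 16 * q * (/ 2) ^ n) with (q * (/ 16 * (/ 2) ^ n)) by ring.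
    apply Rmult_le_compat_l; [lra|].
    apply Rmult_le_compat; nra. }
  assert (I := pow_le (INR (S (S n))) 2 (pos_INR _)).
  apply Rle_trans with (q ^ S (S (S n)) * (4 ^ S n * d)).
  - apply Rmult_le_compat; try lra; [apply Rabs_pos|].
    eapply Rle_trans; [exact A|]. apply Rmult_le_compat_r; lra.
  - rewrite <- Rmult_assoc.
    replace (/ 16 * q * d * (/ 2) ^ n) with (/ 16 * q * (/ 2) ^ n * d) by ring.
    apply Rmult_le_compat_r; lra. }
assert (Hg : is_series (fun n => (/ 2) ^ n) (/ (1 - / 2))) by (apply is_series_geom; rewrite Rabs_pos_eq; lra).
assert (He : ex_series (fun n => / 16 * q * d * (/ 2) ^ n))
  by exact (ex_series_scal_l (/ 16 * q * d) _ (ex_intro _ _ Hg)).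
assert (Ha : ex_series (fun n => Rabs (w (S n)))).
{ eapply ex_series_Rle; [|exact He]. intros n. rewrite Rabs_Rabsolu. apply Hw. }
assert (B := Series_Rabs _ Ha). assert (B' := Series_le _ _ Hw He).
rewrite Series_scal_l, (is_series_unique (pow _) _ Hg) in B'.
assert (D := Rle_trans _ _ _ B B'). apply Rabs_le_between in D.
replace (/ (1 - / 2)) with 2 in D by lra.
assert (0 < q * d) by nra. lra.
Qed.

(** Along the curve the first coordinate decreases, hence the second, being its
    mirror image, increases; both are positive. *)
Lemma turning_small q : 0 < q <= / 8 -> turning q.
Proof.
intros Hq. split; [intros t _; apply theta_pos_small; lra|].
intros x y Hx Hxy Hy. unfold wronskian.
assert (A := theta_decr_small q x y Hq Hx Hxy Hy).
assert (B := theta_decr_small q (PI / 2 - y) (PI / 2 - x) Hq ltac:(lra) ltac:(lra) ltac:(lra)).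
assert (C := theta_pos_small q y ltac:(lra)).
assert (D := theta_pos_small q (PI / 2 - x) ltac:(lra)). nra.
Qed.

(** * From the nome q^2 to the nome q *)

Lemma Rabs_theta_le q t : 0 <= q < 1 -> Rabs (theta q t) <= theta q 0.
Proof.
intros Hq.
assert (Hs : forall x, Zsummable (fun k => q ^ Z.abs_nat (k * k) * cos (2 * IZR k * x)))
  by (intros x; apply Zsummable_gauss; [exact Hq|intros; apply Rabs_cos_le]).
assert (Hk : forall k, 0 <= q ^ Z.abs_nat (k * k)) by (intros k; apply pow_le; lra).
apply Rabs_le; split.
- enough (- 1 * theta q t <= theta q 0) by lra.
  unfold theta. rewrite <- Zsum_scal. apply Zsum_le; [apply Zsummable_scal, Hs|apply Hs|].
  intros k. rewrite Rmult_0_r, cos_0.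
  assert (A := Hk k). assert (B := COS_bound (2 * IZR k * t)). nra.
- apply Zsum_le; [apply Hs|apply Hs|]. intros k.
  apply Rmult_le_compat_l; [apply Hk|]. rewrite Rmult_0_r, cos_0. apply COS_bound.
Qed.

(** With [a = theta q 0] and [b = theta q (PI / 2)], [theta_landen] says that the
    coordinates of the [q^2]-curve have as squares the image of the [q]-curve
    under the linear map [(f, g) |-> ((a f + b g) / 2, (a g + b f) / 2)], whose
    determinant [(a^2 - b^2) / 4] is nonnegative. Squaring positive coordinates
    preserves the sense of rotation, so the [q]-curve turns in the same sense.
    Being counterclockwise of [(a, b)] and clockwise of [(b, a)], with
    [0 < b <= a], its points then have positive coordinates. *)
Lemma turning_descent q : 0 < q < 1 -> turning (q ^ 2) -> turning q.
Proof.
intros Hq [Hpos HW].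
assert (Lan := fun t => theta_landen q t ltac:(lra)).
set (a := theta q 0) in *. set (b := theta q (PI / 2)) in *.
assert (HPI := PI_RGT_0).
assert (Hba : - a <= b <= a) by (apply Rabs_le_between, Rabs_theta_le; lra).
(* The identity at [PI / 2], where both products are [a b]. *)
assert (Hab : 0 < a * b).
{ assert (A := Lan (PI / 2)). replace (PI / 2 - PI / 2) with 0 in A by ring. fold a b in A.
  assert (B := pow_lt _ 2 (Hpos (PI / 2) ltac:(lra))). rewrite A in B. lra. }
assert (Hb : 0 < b) by (destruct (Rle_or_lt b 0); nra).
assert (W : forall x y, 0 <= x -> x < y -> y <= PI / 2 -> 0 < wronskian q x y).
{ intros x y Hx Hxy Hy.
  assert (Lx := Lan x). assert (Ly := Lan y).
  assert (Lx' := Lan (PI / 2 - x)). assert (Ly' := Lan (PI / 2 - y)).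
  replace (PI / 2 - (PI / 2 - x)) with x in Lx' by ring.
  replace (PI / 2 - (PI / 2 - y)) with y in Ly' by ring.
  assert (Px := Hpos x ltac:(lra)). assert (Py := Hpos y ltac:(lra)).
  assert (Px' := Hpos (PI / 2 - x) ltac:(lra)). assert (Py' := Hpos (PI / 2 - y) ltac:(lra)).
  assert (Wxy := HW x y Hx Hxy Hy). unfold wronskian in *.
  set (F := theta (q ^ 2)) in *.
  assert (E : F x ^ 2 * F (PI / 2 - y) ^ 2 - F y ^ 2 * F (PI / 2 - x) ^ 2 =
    / 4 * (a ^ 2 - b ^ 2) *
      (theta q x * theta q (PI / 2 - y) - theta q y * theta q (PI / 2 - x))).
  { rewrite Lx, Ly, Lx', Ly'. field. }
  assert (E' : 0 < F x ^ 2 * F (PI / 2 - y) ^ 2 - F y ^ 2 * F (PI / 2 - x) ^ 2).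
  { replace (_ - _) with ((F x * F (PI / 2 - y) - F y * F (PI / 2 - x)) *
      (F x * F (PI / 2 - y) + F y * F (PI / 2 - x))) by ring.
    apply Rmult_lt_0_compat; [exact Wxy|].
    apply Rplus_lt_0_compat; now apply Rmult_lt_0_compat. }
  rewrite E in E'. assert (0 <= a ^ 2 - b ^ 2) by nra. nra. }
split; [|exact W].
intros t Ht.
destruct (Req_dec t 0) as [->|H0]; [unfold a in *; nra|].
destruct (Req_dec t (PI / 2)) as [->|H1]; [exact Hb|].
assert (A := W 0 t ltac:(lra) ltac:(lra) ltac:(lra)).
assert (B := W t (PI / 2) ltac:(lra) ltac:(lra) ltac:(lra)).
unfold wronskian in A, B.
replace (PI / 2 - PI / 2) with 0 in B by ring.
replace (PI / 2 - 0) with (PI / 2) in A by ring. fold a b in A, B.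
set (f := theta q t) in *. set (g := theta q (PI / 2 - t)) in *.
assert (C : 0 < (a ^ 2 - b ^ 2) * f).
{ replace ((a ^ 2 - b ^ 2) * f) with (a * (f * a - b * g) + b * (a * g - f * b)) by ring.
  apply Rplus_lt_0_compat; apply Rmult_lt_0_compat; lra. }
assert (0 <= a ^ 2 - b ^ 2) by nra. nra.
Qed.

(** The nomes [q^(2^n)] tend to 0, so the descent starts from [turning_small]. *)
Lemma turning_nome q : 0 < q < 1 -> turning q.
Proof.
intros Hq.
assert (D : forall n p, 0 < p < 1 -> turning (p ^ (2 ^ n)) -> turning p).
{ induction n as [|n IH]; intros p Hp H.
  - simpl in H. now rewrite Rmult_1_r in H.
  - apply turning_descent; [exact Hp|]. apply IH; [simpl; nra|].
    rewrite <- pow_mult. exact H. }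
destruct (pow_lt_1_zero q ltac:(rewrite Rabs_pos_eq; lra) (/ 8) ltac:(lra)) as [N HN].
apply (D N q Hq), turning_small.
assert (A := HN (2 ^ N)%nat (Nat.lt_le_incl _ _ (Nat.pow_gt_lin_r 2 N ltac:(lia)))).
assert (B := pow_lt q (2 ^ N) ltac:(lra)).
rewrite Rabs_pos_eq in A; lra.
Qed.

(** After clearing denominators, [theta_landen] turns the difference into the
    wronskian times [theta q (PI / 2) / 2]: the terms in [theta q 0] cancel. *)
Lemma quotient_decr q x y : 0 < q < 1 -> 0 <= x -> x < y -> y <= PI / 2 ->
  theta q y / theta (q ^ 2) y ^ 2 < theta q x / theta (q ^ 2) x ^ 2.
Proof.
intros Hq Hx Hxy Hy.
destruct (turning_nome q Hq) as [Hpos HW].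
destruct (turning_nome (q ^ 2) ltac:(simpl; nra)) as [Hpos2 _].
assert (HPI := PI_RGT_0).
assert (Wxy := HW x y Hx Hxy Hy). unfold wronskian in Wxy.
assert (Dx := pow_lt _ 2 (Hpos2 x ltac:(lra))). assert (Dy := pow_lt _ 2 (Hpos2 y ltac:(lra))).
assert (Hb := Hpos (PI / 2) ltac:(lra)).
enough (0 < theta q x * theta (q ^ 2) y ^ 2 - theta q y * theta (q ^ 2) x ^ 2).
{ set (X := theta (q ^ 2) x ^ 2) in *. set (Y := theta (q ^ 2) y ^ 2) in *.
  apply Rmult_lt_reg_r with (X * Y); [now apply Rmult_lt_0_compat|].
  replace (theta q y / Y * (X * Y)) with (theta q y * X) by (field; lra).
  replace (theta q x / X * (X * Y)) with (theta q x * Y) by (field; lra). lra. }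
rewrite !theta_landen by lra.
replace (_ - _) with (/ 2 * theta q (PI / 2) *
  (theta q x * theta q (PI / 2 - y) - theta q y * theta q (PI / 2 - x))) by ring.
apply Rmult_lt_0_compat; lra.
Qed.

(** * The complex series and the real theta function *)

Lemma is_series_C (a b : nat -> R) (la lb : R) :
  is_series a la -> is_series b lb ->
  @is_series C_AbsRing C_NormedModule (fun n => (a n, b n)) (la, lb).
Proof.
intros Ha Hb.
assert (Hs : forall N, @sum_n C_NormedModule (fun n => (a n, b n)) N = (sum_n a N, sum_n b N)).
{ induction N as [|N IH]; [now rewrite !sum_O|]. now rewrite !sum_Sn, IH. }
apply (filterlim_ext (fun N => (sum_n a N, sum_n b N) : CC)); [now intros N|].
apply filterlim_locally. intros eps.
assert (Ha' := proj1 (filterlim_locally _ _) Ha eps).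
assert (Hb' := proj1 (filterlim_locally _ _) Hb eps).
exact (filter_and _ _ Ha' Hb').
Qed.

Lemma theta3_real q t : 0 <= q < 1 -> theta3 (RtoC t) (RtoC q) = RtoC (theta q t).
Proof.
intros Hq. apply is_bilateral_series_unique.
set (c := fun k => q ^ Z.abs_nat (k * k) * cos (2 * IZR k * t)).
set (s := fun k => q ^ Z.abs_nat (k * k) * sin (2 * IZR k * t)).
assert (Hc : Zsummable c) by (apply Zsummable_gauss; [exact Hq|intros; apply Rabs_cos_le]).
assert (Hs : Zsummable s) by (apply Zsummable_gauss; [exact Hq|intros; apply Rabs_sin_le]).
assert (E : forall k, (c k, s k) = theta3_term (RtoC t) (RtoC q) k).
{ intros k. unfold theta3_term, c, s. rewrite <- RtoC_pow.
  set (p := q ^ _). unfold Cexp.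
  replace (RtoC 2 * Ci * (RtoC (IZR k) * RtoC t))%C with ((0, 2 * IZR k * t) : CC)
    by (apply injective_projections; simpl; ring).
  simpl. rewrite exp_0. apply injective_projections; simpl; ring. }
destruct (Zsummable_tails _ Hc) as [C1 C2]. destruct (Zsummable_tails _ Hs) as [S1 S2].
exists (Series (fun n => c (Z.of_nat n)), Series (fun n => s (Z.of_nat n))),
  (Series (fun n => c (- Z.of_nat (S n))%Z), Series (fun n => s (- Z.of_nat (S n))%Z)).
split; [|split].
- eapply is_series_ext; [intros n; apply E|]. apply is_series_C; now apply Series_correct.
- eapply is_series_ext; [intros n; apply (E (- Z.of_nat (S n))%Z)|].
  apply is_series_C; now apply Series_correct.
- assert (Ec := Zsum_split _ Hc). assert (Es := Zsum_split _ Hs).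
  assert (Z := Zsum_gauss_sin q t Hq). change (Zsum s = 0) in Z.
  rewrite Z in Es. apply injective_projections; [exact Ec|exact Es].
Qed.

Lemma Pquot_real q t : 0 < q < 1 -> 0 <= t <= PI ->
  Pquot q t = RtoC (theta q t / theta (q ^ 2) t ^ 2).
Proof.
intros Hq Ht. assert (Hq2 : 0 < q ^ 2 < 1) by (simpl; nra).
destruct (turning_nome _ Hq2) as [Hpos _].
assert (Hp : 0 < theta (q ^ 2) t).
{ destruct (Rle_dec t (PI / 2)); [apply Hpos; lra|].
  rewrite <- theta_PI_minus. apply Hpos; lra. }
unfold Pquot. rewrite !theta3_real by lra. rewrite <- RtoC_pow, RtoC_div; [reflexivity|].
apply pow_nonzero. lra.
Qed.

(** * Monotonicity of the quotient *)

Theorem theorem5 (sigma : R) (hsigma : 0 < sigma) :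
  let q : R := exp (- (1 / (4 * sigma ^ 2))) in
  let P : R -> R := fun t => Re (Pquot q t) in
  (forall t : R, 0 <= t <= PI -> Pquot q t = RtoC (P t)) /\
  (forall x y : R, 0 < x -> x < y -> y < PI / 2 -> P y < P x) /\
  (forall x y : R, PI / 2 < x -> x < y -> y < PI -> P x < P y).
Proof.
intros q P.
assert (Hq : 0 < q < 1).
{ split; [apply exp_pos|]. rewrite <- exp_0. apply exp_increasing.
  assert (0 < 1 / (4 * sigma ^ 2)) by (apply Rdiv_lt_0_compat; [lra|nra]). lra. }
assert (HP : forall t, 0 <= t <= PI -> P t = theta q t / theta (q ^ 2) t ^ 2).
{ intros t Ht. unfold P. now rewrite Pquot_real. }
split; [|split].
- intros t Ht. unfold P. now rewrite Pquot_real.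
- intros x y Hx Hxy Hy. rewrite !HP by lra. apply quotient_decr; lra.
- intros x y Hx Hxy Hy. rewrite !HP by lra.
  (* The reflection [t |-> PI - t] fixes both theta functions. *)
  rewrite <- (theta_PI_minus q x), <- (theta_PI_minus q y),
    <- (theta_PI_minus (q ^ 2) x), <- (theta_PI_minus (q ^ 2) y).
  apply quotient_decr; lra.
Qed.
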